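(* Let $A=\sigma(R)\langle x_1,\dots,x_n\rangle$ be a skew PBW extension of a ring $R$ with associated families $\Sigma=\{\sigma_1,\dots,\sigma_n\}$ and $\Delta=\{\delta_1,\dots,\delta_n\}$. Suppose that the elements $c_{i,j}$ are central in $R$ for all $i,j$, that $\sigma_i\delta_j=\delta_j\sigma_i$ and $\delta_i\delta_j=\delta_j\delta_i$ for all $1\le i,j\le n$, and that $\delta_k(c_{i,j})=\delta_k(r_l^{(i,j)})=0$ for all $i,j,k,l$. Let $\overline{\Sigma}=\{\overline{\sigma_1},\dots,\overline{\sigma_n}\}$ and $\overline{\Delta}=\{\overline{\delta_1},\dots,\overline{\delta_n}\}$ be the families of coefficientwise extensions to $A$ of the maps in $\Sigma$ and $\Delta$. If $R$ is $(\Sigma,\Delta)$-compatible and reversible, then $R$ is a weak $(\Sigma,\Delta)$-symmetric ring if and only if $A$ is a weak $(\overline{\Sigma},\overline{\Delta})$-symmetric ring.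
   Context: Rings are associative with unity, not necessarily commutative. For a ring $B$, $\mathrm{nil}(B)$ is the set of nilpotent elements of $B$. Skew PBW extension: a ring $A$ is a skew PBW extension of a ring $R$, written $A=\sigma(R)\langle x_1,\dots,x_n\rangle$, if: (i) $R\subseteq A$ (as a subring); (ii) there are $x_1,\dots,x_n\in A$ such that $A$ is a left free $R$-module with basis $\mathrm{Mon}(A)=\{x^{\alpha}=x_1^{\alpha_1}\cdots x_n^{\alpha_n}\mid \alpha\in\mathbb{N}^n\}$, where $x_1^0\cdots x_n^0=1$; (iii) for each $i$ and each $r\in R\setminus\{0\}$ there is $c_{i,r}\in R\setminus\{0\}$ with $x_ir-c_{i,r}x_i\in R$; (iv) for all $1\le i,j\le n$ there are $c_{i,j}\in R\setminus\{0\}$ and $r_0^{(i,j)},r_1^{(i,j)},\dots,r_n^{(i,j)}\in R$ with $x_jx_i-c_{i,j}x_ix_j=r_0^{(i,j)}+\sum_{l=1}^n r_l^{(i,j)}x_l$. It is known that for each $i$ there are an injective endomorphism $\sigma_i:R\to R$ and a $\sigma_i$-derivation $\delta_i:R\to R$ (i.e. $\delta_i$ is additive and $\delta_i(rs)=\sigma_i(r)\delta_i(s)+\delta_i(r)s$) such that $x_ir=\sigma_i(r)x_i+\delta_i(r)$ for all $r\in R$; these form the associated families $\Sigma$ and $\Delta$. Coefficientwise extensions: for $f=a_0+a_1X_1+\cdots+a_mX_m\in A$ with $a_i\in R$ and $X_i\in\mathrm{Mon}(A)$, $\overline{\sigma_k}(f)=\sigma_k(a_0)+\sigma_k(a_1)X_1+\cdots+\sigma_k(a_m)X_m$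 and $\overline{\delta_k}(f)=\delta_k(a_0)+\delta_k(a_1)X_1+\cdots+\delta_k(a_m)X_m$. For $\alpha,\beta\in\mathbb{N}^n$ put $\sigma^\alpha=\sigma_1^{\alpha_1}\cdots\sigma_n^{\alpha_n}$ and $\delta^\beta=\delta_1^{\beta_1}\cdots\delta_n^{\beta_n}$ (compositions). $R$ is $(\Sigma,\Delta)$-compatible if for all $a,b\in R$: for every $\alpha\in\mathbb{N}^n$, $a\sigma^\alpha(b)=0$ if and only if $ab=0$; and $ab=0$ implies $a\delta^\beta(b)=0$ for every $\beta\in\mathbb{N}^n$. $R$ is reversible if $ab=0$ implies $ba=0$ for all $a,b\in R$. $R$ is weak $(\Sigma,\Delta)$-symmetric if for all $a,b,c\in R$ and every $i$, $abc\in\mathrm{nil}(R)$ implies $ac\sigma_i(b)\in\mathrm{nil}(R)$ and $ac\delta_i(b)\in\mathrm{nil}(R)$. Similarly, $A$ is weak $(\overline{\Sigma},\overline{\Delta})$-symmetric if for all $f,g,h\in A$ and every $i$, $fgh\in\mathrm{nil}(A)$ implies $fh\overline{\sigma_i}(g)\in\mathrm{nil}(A)$ and $fh\overline{\delta_i}(g)\in\mathrm{nil}(A)$. *)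

(* Defs.v *)
From mathcomp Require Import all_boot all_algebra.
From mathcomp Require Import finmap.

Set Implicit Arguments.
Unset Strict Implicit.
Unset Printing Implicit Defensive.

Import GRing.Theory.
Local Open Scope ring_scope.

Definition is_nilpotent (B : pzRingType) (a : B) : Prop :=
  exists k : nat, a ^+ k = 0.

Definition reversible (B : pzRingType) : Prop :=
  forall a b : B, a * b = 0 -> b * a = 0.

Notation expo n := {ffun 'I_n -> nat}.

(* The product is taken in increasing order of i: the x i need not commute. *)
Definition monomial (n : nat) (A : pzRingType) (x : 'I_n -> A)
    (alpha : expo n) : A :=
  \prod_(i < n) x i ^+ alpha i.

(* Finitely supported families of coefficients, indexed by exponents. *)
Notation coefs n R := {fsfun expo n -> R with 0}.

Definition lincomb (n : nat) (R A : pzRingType) (iota : R -> A) (x : 'I_n -> A)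
    (c : coefs n R) : A :=
  \sum_(alpha <- finsupp c) iota (c alpha) * monomial x alpha.

(* The inclusion of R in A is the injective morphism pbw_iota, and A is a left
   R-module through r . a = pbw_iota r * a.  Being free with basis Mon(A) is
   split into generation and uniqueness of the coefficients.  The index of the
   coefficients r^(i,j) is shifted: ord0 is the constant term and lift ord0 l
   goes with the variable x l. *)
Record skew_PBW (n : nat) (R A : pzRingType) : Type := SkewPBW {
  pbw_iota : {rmorphism R -> A};
  pbw_x : 'I_n -> A;
  pbw_c : 'I_n -> 'I_n -> R;
  pbw_r : 'I_n -> 'I_n -> 'I_n.+1 -> R;
  pbw_iota_inj : injective pbw_iota;
  pbw_gen : forall f : A, exists c : coefs n R, lincomb pbw_iota pbw_x c == f;
  pbw_free : injective (lincomb pbw_iota pbw_x);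
  pbw_coef : forall (i : 'I_n) (r : R), r != 0 ->
    exists2 c : R, c != 0 &
    exists d : R, pbw_x i * pbw_iota r - pbw_iota c * pbw_x i = pbw_iota d;
  pbw_c_neq0 : forall i j : 'I_n, pbw_c i j != 0;
  pbw_comm : forall i j : 'I_n,
    pbw_x j * pbw_x i - pbw_iota (pbw_c i j) * (pbw_x i * pbw_x j) =
    pbw_iota (pbw_r i j ord0) +
    \sum_(l < n) pbw_iota (pbw_r i j (lift ord0 l)) * pbw_x l
}.

(* The relation assoc_rel determines Sigma and Delta, by freeness. *)
Record associated_families (n : nat) (R A : pzRingType) (P : skew_PBW n R A)
    (Sigma Delta : 'I_n -> R -> R) : Prop := AssociatedFamilies {
  assoc_sigma_add : forall i, {morph Sigma i : r s / r + s};
  assoc_sigma_mul : forall i, {morph Sigma i : r s / r * s};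
  assoc_sigma_one : forall i, Sigma i 1 = 1;
  assoc_sigma_inj : forall i, injective (Sigma i);
  assoc_delta_add : forall i, {morph Delta i : r s / r + s};
  assoc_delta_mul : forall i (r s : R),
    Delta i (r * s) = Sigma i r * Delta i s + Delta i r * s;
  assoc_rel : forall i (r : R),
    pbw_x P i * pbw_iota P r =
    pbw_iota P (Sigma i r) * pbw_x P i + pbw_iota P (Delta i r)
}.

Section Coefficientwise.

Variables (n : nat) (R A : pzRingType) (P : skew_PBW n R A).

Definition coords (f : A) : coefs n R := xchoose (pbw_gen P f).

Lemma coordsK (f : A) : lincomb (pbw_iota P) (pbw_x P) (coords f) = f.
Proof. exact/eqP/(xchooseP (pbw_gen P f)). Qed.

Lemma lincombK (c : coefs n R) :
  coords (lincomb (pbw_iota P) (pbw_x P) c) = c.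
Proof. by apply: (@pbw_free _ _ _ P); rewrite coordsK. Qed.

(* Summing over the support only is harmless when u 0 = 0, which holds for all
   the maps (additive ones) this is applied to. *)
Definition coefwise (u : R -> R) (f : A) : A :=
  \sum_(alpha <- finsupp (coords f))
     pbw_iota P (u (coords f alpha)) * monomial (pbw_x P) alpha.

Definition coefwise_family (U : 'I_n -> R -> R) (i : 'I_n) : A -> A :=
  coefwise (U i).

End Coefficientwise.

(* u^alpha = u_1^(alpha_1) o ... o u_n^(alpha_n), in this order. *)
Definition iter_family (n : nat) (T : Type) (u : 'I_n -> T -> T)
    (alpha : expo n) : T -> T :=
  \big[(fun f g : T -> T => f \o g)/id]_(i < n) iter (alpha i) (u i).

Definition SD_compatible (n : nat) (R : pzRingType)
    (Sigma Delta : 'I_n -> R -> R) : Prop :=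
  forall a b : R,
    (forall alpha : expo n, a * iter_family Sigma alpha b = 0 <-> a * b = 0) /\
    (a * b = 0 -> forall beta : expo n, a * iter_family Delta beta b = 0).

Definition weak_SD_symmetric (n : nat) (B : pzRingType)
    (Sigma Delta : 'I_n -> B -> B) : Prop :=
  forall (a b c : B) (i : 'I_n), is_nilpotent (a * b * c) ->
    is_nilpotent (a * c * Sigma i b) /\ is_nilpotent (a * c * Delta i b).

(* Main.v *)
Require Import Defs.
From mathcomp Require Import all_boot all_algebra.
From mathcomp Require Import finmap.
Import GRing.Theory.
Local Open Scope ring_scope.

(** Both sides of the equivalence hold, each because the relevant ring is
    symmetric modulo its nilpotent elements.

    In a reversible ring R the nilpotent elements form an ideal N with reduced
    quotient ([nil_reduced_ideal]), and in a reduced ring abc = 0 implies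
    acb = 0 ([reduced_ideal_swap]).  Compatibility gives, modulo N, that ab = 0
    if and only if a sigma_i(b) = 0, and that ab = 0 implies a delta_i(b) = 0
    ([nil_Sigma], [nil_Delta], both from [nil_subst]).  So R is weak symmetric.

    For A, let I be the set of the elements all of whose coefficients are in N.
    The point is that I is the set of nilpotent elements of A
    ([nil_iff_nilcoef]), that it is an ideal with reduced quotient
    ([nilcoef_reduced_ideal]), and that ug in I forces every product of a
    coefficient of u and a coefficient of g into N ([nilcoef_armendariz]).
    Then fgh in I gives fhg in I, hence products of coefficients of fh and g in
    N; they stay in N when sigma_i or delta_i is applied to the second factor,
    and [nilcoefM] goes back to A.

    I consists of nilpotent elements: moving a coefficient b to the left of an
    element of A only produces coefficients whose left annihilator contains
    that of b ([pbw_dominated]).  So for a nilpotent a, the ideal generated by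
    a in A is nil, and a finite sum of elements of such ideals is nilpotent
    ([nil_sum]).

    The other two facts come from leading terms ([covers_lead]).  The relations
    between x_i x_j and x_j x_i show c_ij c_ji = 1 ([pbw_c_unit]), so for a
    positive weight on the variables such that every weight is less than the
    sum of any two, the product of the terms a x^alpha and b x^beta is
    a sigma^alpha(b) c x^(alpha+beta) with c right invertible, plus terms of
    smaller weight ([low_mul]).  The weights B^n + B^i moreover separate the
    finitely many exponents at hand once B is large ([sep_weight_inj]), so that
    leading terms are well defined.  Then f^2 in I implies f in I, by removing
    leading terms ([covers_sqr]), and the statement on products of coefficients
    follows by a double induction on the numbers of terms
    ([covers_armendariz]). *)

Set Implicit Arguments.
Unset Strict Implicit.
Unset Printing Implicit Defensive.

(** * Ideals with reduced quotient *)

(** A two-sided ideal, given as a predicate. *)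
Record ideal (B : pzRingType) (K : B -> Prop) : Prop := Ideal {
  ideal0 : K 0;
  idealD : forall a b, K a -> K b -> K (a + b);
  idealMl : forall r a, K a -> K (r * a);
  idealMr : forall r a, K a -> K (a * r)
}.

(** A two-sided ideal whose quotient ring is reduced. *)
Record reduced_ideal (B : pzRingType) (K : B -> Prop) : Prop := ReducedIdeal {
  reduced_ideal_ideal : ideal K;
  reduced_ideal_sqr : forall a, K (a * a) -> K a
}.

Section IdealTheory.

Variables (B : pzRingType) (K : B -> Prop).

Lemma idealN (hK : ideal K) a : K a -> K (- a).
Proof. by rewrite -mulN1r; apply: idealMl. Qed.

Lemma idealB (hK : ideal K) a b : K a -> K b -> K (a - b).
Proof. by move=> Ka Kb; apply: idealD => //; apply: idealN. Qed.

Hypothesis hK : reduced_ideal K.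
Let hI := reduced_ideal_ideal hK.

Lemma reduced_idealC a b : K (a * b) -> K (b * a).
Proof.
move=> Kab; apply: (reduced_ideal_sqr hK).
by rewrite -mulrA (mulrA a); apply/(idealMl hI)/(idealMr hI).
Qed.

Lemma reduced_ideal_ins a b r : K (a * b) -> K (a * r * b).
Proof.
move=> Kab.
have: K (b * a * r) by apply/(idealMr hI)/reduced_idealC.
by rewrite -mulrA => /reduced_idealC.
Qed.

(** The quotient by a reduced ideal is symmetric: the factors a, b, c occur in
    this order in (a c b)^2. *)
Lemma reduced_ideal_swap a b c : K (a * b * c) -> K (a * c * b).
Proof.
move=> Kabc; apply: (reduced_ideal_sqr hK).
have K1 : K (a * c * b * c).
  by rewrite -(mulrA (a * c)); apply: reduced_ideal_ins; rewrite mulrA.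
have K2 := reduced_ideal_ins a K1.
by rewrite !mulrA; apply: (idealMr hI).
Qed.

Lemma reduced_ideal_cancel a b : K (a * a * b) -> K (a * b).
Proof.
move=> /reduced_ideal_swap Kaba; apply: (reduced_ideal_sqr hK).
by rewrite mulrA; apply: (idealMr hI).
Qed.

Lemma reduced_ideal_nil a : is_nilpotent a -> K a.
Proof.
case=> k ak0; have: K (a ^+ k) by rewrite ak0; apply: ideal0.
case: k {ak0} => [Ka0|k].
  by rewrite -(mulr1 a) -(expr0 a); apply: idealMl.
(* a^(2k+2) = a^k a^(k+2) *)
elim: k => // k IHk Kak; apply: IHk; apply: (reduced_ideal_sqr hK).
by rewrite {1}exprSr -mulrA -exprS; apply: idealMl.
Qed.

End IdealTheory.

(** * Reversible rings *)

Lemma reversible_ins (B : pzRingType) (hB : reversible B) (a b r : B) :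
  a * b = 0 -> a * (r * b) = 0.
Proof.
by move=> /hB ba0; rewrite mulrA; apply: hB; rewrite mulrA ba0 mul0r.
Qed.

(** In a reversible ring, an inclusion between left annihilators, from that of
    b into that of t, holds modulo the nilpotent elements as well. *)
Lemma nil_subst (B : pzRingType) (hB : reversible B) (a b t : B) :
  (forall z, z * b = 0 -> z * t = 0) ->
  is_nilpotent (a * b) -> is_nilpotent (a * t).
Proof.
move=> bt [k abk0]; exists k.
suff h p q : (a * t) ^+ p * (a * b) ^+ q = 0 -> (a * t) ^+ (p + q) = 0.
  by apply: (h 0%N); rewrite expr0 mul1r.
elim: q p => [|q IHq] p; first by rewrite addn0 expr0 mulr1.
rewrite exprSr !mulrA => /bt; rewrite -mulrA => /hB.
by rewrite mulrA -exprS addnS -addSn => /IHq.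
Qed.

(** * Nilpotent elements and dominated products *)

Section Domination.

Variables (R A : pzRingType) (iota : {rmorphism R -> A}).

(** The right A-submodule of A generated by the images of the b' whose left
    annihilator contains that of b. *)
Inductive dominated (b : R) : A -> Prop :=
| dominated_gen b' v of (forall z, z * b = 0 -> z * b' = 0) :
    dominated b (iota b' * v)
| dominated_add v w of dominated b v & dominated b w : dominated b (v + w).

Lemma dominated_trans b b1 v w : (forall z, z * b = 0 -> z * b1 = 0) ->
  dominated b1 v -> dominated b (v * w).
Proof.
move=> bb1; elim=> {v} [b' v bb'|v v' _ IHv _ IHv'].
  by rewrite -mulrA; constructor=> z /bb1/bb'.
by rewrite mulrDl; constructor.
Qed.

Hypothesis dom_mul : forall (w : A) (b : R), dominated b (w * iota b).

(** For every b in R, if a^m b = 0 then f A b = 0. When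
    [dominated iota b (w * iota b)] always holds, this is the case of a product
    of elements of A in which m factors are a. *)
Definition annihilates (a : R) (m : nat) (f : A) : Prop :=
  forall (b : R) (w : A), a ^+ m * b = 0 -> f * w * iota b = 0.

(** In the sense of [annihilates], right multiplication by h contributes one
    more factor a. *)
Definition divisible (a : R) (h : A) : Prop :=
  forall m f, annihilates a m f -> annihilates a m.+1 (f * h).

Lemma divisible_ideal a : ideal (divisible a).
Proof.
split=> [m f _ b w _|h h' Dh Dh' m f Lf b w ab|r h Dh m f Lf b w ab|
         r h Dh m f Lf b w ab].
- by rewrite mulr0 !mul0r.
- by rewrite mulrDr !mulrDl (Dh m) // (Dh' m) // addr0.
- rewrite mulrA; apply: (Dh m) => // b' w' /Lf.
  by rewrite -(mulrA f).
- by rewrite mulrA -(mulrA _ r); apply: (Dh m).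
Qed.

Lemma divisible_iota a : divisible a (iota a).
Proof.
move=> m f Lf b w ab; rewrite -mulrA.
elim: (dom_mul w b) => [b' v bb'|v v' _ IHv _ IHv'].
  rewrite mulrA -(mulrA f) -rmorphM -(mulr1 f) Lf ?mul0r //.
  by rewrite mulrA -exprSr; apply: bb'.
by rewrite mulrDr IHv IHv' addr0.
Qed.

Lemma divisible_nil a h : is_nilpotent a -> divisible a h -> is_nilpotent h.
Proof.
case=> k ak0 Dh; exists k.
suff /(_ 1 1): annihilates a k (h ^+ k).
  by rewrite ak0 mul0r rmorph1 !mulr1; apply.
elim: k {ak0} => [b w|k IHk]; last by rewrite exprSr; apply: Dh.
by rewrite expr0 mul1r => ->; rewrite rmorph0 mulr0.
Qed.

Lemma nil_addl a f h : is_nilpotent a -> is_nilpotent f -> divisible a h ->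
  is_nilpotent (f + h).
Proof.
move=> nila [k fk0] Dh; have hD := divisible_ideal a.
have: divisible a ((f + h) ^+ k - f ^+ k).
  elim: k {fk0} => [|k IHk]; first by rewrite !expr0 subrr; apply: ideal0.
  have -> : (f + h) ^+ k.+1 - f ^+ k.+1 =
            f * ((f + h) ^+ k - f ^+ k) + h * (f + h) ^+ k.
    by rewrite !exprS mulrDl mulrBr addrAC.
  by apply: (idealD hD); [apply: (idealMl hD) | apply: (idealMr hD)].
rewrite fk0 subr0 => /(divisible_nil nila) [m]; rewrite -exprM => hm.
by exists (k * m)%N.
Qed.

Lemma nil_sum (I : eqType) (s : seq I) (a : I -> R) (v : I -> A) :
  (forall i, i \in s -> is_nilpotent (a i)) ->
  is_nilpotent (\sum_(i <- s) iota (a i) * v i).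
Proof.
elim: s => [_|i s IHs ha]; first by rewrite big_nil; exists 1%N; rewrite expr1.
rewrite big_cons addrC; apply: (@nil_addl (a i)).
- by apply: ha; rewrite mem_head.
- by apply: IHs => j js; apply: ha; rewrite in_cons js orbT.
- by apply: (idealMr (divisible_ideal _)); apply: divisible_iota.
Qed.

End Domination.

(** The nilpotent elements of a reversible ring form a reduced ideal. *)
Lemma nil_reduced_ideal (B : pzRingType) (hB : reversible B) :
  reduced_ideal (@is_nilpotent B).
Proof.
have dom (w b : B) : dominated idfun b (w * idfun b).
  rewrite -(mulr1 (_ * _)); apply: (@dominated_gen _ _ idfun b (w * b)).
  by move=> z; apply: reversible_ins.
have nil0 : is_nilpotent (0 : B) by exists 1%N; rewrite expr1.
have Da (a : B) : divisible idfun a a by apply: (divisible_iota dom).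
split; first split=> //.
- by move=> a b nila nilb; apply: nil_addl nilb nila _.
- move=> r a nila; rewrite -(add0r (r * a)); apply: nil_addl nila nil0 _.
  exact: (idealMl (divisible_ideal _ a)).
- move=> r a nila; rewrite -(add0r (a * r)); apply: nil_addl nila nil0 _.
  exact: (idealMr (divisible_ideal _ a)).
- by move=> a [k]; rewrite -expr2 -exprM; exists (2 * k)%N.
Qed.
(** * Coordinates in a skew PBW extension *)

Section Coordinates.

Variables (n : nat) (R A : pzRingType) (P : skew_PBW n R A).

Local Notation iota := (pbw_iota P).
Local Notation x := (pbw_x P).
Local Notation mon := (monomial (pbw_x P)).
Local Notation co := (coords P).

Lemma coords_sum (S : {fset expo n}) (a : expo n -> R) (be : expo n) :
  co (\sum_(al <- S) iota (a al) * mon al) be = if be \in S then a be else 0.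
Proof.
pose c : coefs n R := [fsfun al in S => a al].
have -> : \sum_(al <- S) iota (a al) * mon al = lincomb iota x c.
  rewrite /lincomb (@big_fset_incl _ _ _ _ (finsupp c) S).
  - by apply: eq_big_seq => al alS; rewrite fsfunE alS.
  - apply/fsubsetP => al; rewrite mem_finsupp fsfunE.
    by case: ifP => //; rewrite eqxx.
  - by move=> al _ /fsfun_dflt ->; rewrite rmorph0 mul0r.
by rewrite lincombK fsfunE.
Qed.

Lemma coords_expand (S : {fset expo n}) (f : A) :
  (finsupp (co f) `<=` S)%fset -> f = \sum_(al <- S) iota (co f al) * mon al.
Proof.
move=> sub; rewrite -[LHS](coordsK P) /lincomb.
by apply: big_fset_incl => // al _ /fsfun_dflt ->; rewrite rmorph0 mul0r.
Qed.

Lemma coordsE (f : A) :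
  f = \sum_(al <- finsupp (co f)) iota (co f al) * mon al.
Proof. exact: coords_expand. Qed.

Lemma coordsD (f g : A) (al : expo n) : co (f + g) al = co f al + co g al.
Proof.
have Ef := coords_expand (fsubsetUl (finsupp (co f)) (finsupp (co g))).
have Eg := coords_expand (fsubsetUr (finsupp (co f)) (finsupp (co g))).
rewrite [X in co (X + _)]Ef [X in co (_ + X)]Eg -big_split /=.
under eq_bigr => i _ do rewrite -mulrDl -rmorphD.
rewrite (coords_sum _ (fun i => co f i + co g i)) in_fsetU.
case: ifP => // /negbT; rewrite negb_or => /andP[fal gal].
by rewrite !fsfun_dflt ?addr0.
Qed.

Lemma coordsMl (r : R) (f : A) (al : expo n) :
  co (iota r * f) al = r * co f al.
Proof.
rewrite {1}(coordsE f) mulr_sumr.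
under eq_bigr => i _ do rewrite mulrA -rmorphM.
rewrite (coords_sum _ (fun i => r * co f i)).
by case: finsuppP; rewrite ?mulr0.
Qed.

Lemma coordsN (f : A) (al : expo n) : co (- f) al = - co f al.
Proof.
by rewrite -[- f]mulN1r -[- co f al]mulN1r -(rmorphN1 iota) coordsMl.
Qed.

Lemma coordsB (f g : A) (al : expo n) : co (f - g) al = co f al - co g al.
Proof. by rewrite coordsD coordsN. Qed.

Lemma coords0 (al : expo n) : co 0 al = 0.
Proof. by rewrite -(subrr (0 : A)) coordsB subrr. Qed.

Lemma coords_bigsum (I : Type) (s : seq I) (F : I -> A) (al : expo n) :
  co (\sum_(i <- s) F i) al = \sum_(i <- s) co (F i) al.
Proof.
apply: (big_morph (fun f => co f al)) => [f g|]; first exact: coordsD.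
exact: coords0.
Qed.

Lemma coords_term (a : R) (al be : expo n) :
  co (iota a * mon al) be = if be == al then a else 0.
Proof.
have := coords_sum [fset al]%fset (fun=> a) be.
by rewrite big_seq_fset1 in_fset1.
Qed.

Lemma coords_coefwise (u : R -> R) (f : A) (al : expo n) :
  u 0 = 0 -> co (coefwise P u f) al = u (co f al).
Proof.
move=> u0; rewrite /coefwise (coords_sum _ (fun i => u (co f i))).
by case: finsuppP; rewrite ?u0.
Qed.

(** ** Words in the variables *)

(** The composite of a family of maps along a word. *)
Definition word_sigma (Sigma : 'I_n -> R -> R) (s : seq 'I_n) (r : R) : R :=
  foldr Sigma r s.

(** The product of the variables along a word. *)
Definition wordprod (s : seq 'I_n) : A := \prod_(i <- s) x i.

(** The weakly increasing word of a given exponent. *)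
Definition expo_word (al : expo n) : seq 'I_n :=
  flatten [seq nseq (al i) i | i <- enum 'I_n].

(** The exponent counting the occurrences of each variable in a word. *)
Definition word_expo (s : seq 'I_n) : expo n := [ffun i => count_mem i s].

Lemma wordprod_cons i s : wordprod (i :: s) = x i * wordprod s.
Proof. exact: big_cons. Qed.

Lemma wordprod_cat s t : wordprod (s ++ t) = wordprod s * wordprod t.
Proof. exact: big_cat. Qed.

Lemma wordprod_expo (al : expo n) : wordprod (expo_word al) = mon al.
Proof.
have -> : mon al = \prod_(i <- enum 'I_n) x i ^+ al i.
  by rewrite enumT /monomial [index_enum _]unlock.
rewrite /wordprod big_flatten big_map /=.
apply: eq_bigr => i _; elim: (al i) => [|k IHk] /=.
  by rewrite big_nil expr0.
by rewrite big_cons IHk exprS.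
Qed.

Lemma count_expo_word (al : expo n) i : count_mem i (expo_word al) = al i.
Proof.
rewrite count_flatten -map_comp sumnE big_map big_enum /= (bigD1 i) //=.
rewrite count_nseq /= eqxx mul1n big1 ?addn0 // => j ji.
by rewrite count_nseq /= (negbTE ji).
Qed.

Lemma perm_expo_word s al : word_expo s = al -> perm_eq s (expo_word al).
Proof.
move=> <-; apply/allP => i _ /=.
by rewrite count_expo_word ffunE.
Qed.

Let leo : rel 'I_n := fun i j => (i <= j)%N.

Lemma sorted_expo_word al : sorted leo (expo_word al).
Proof.
apply: pairwise_sorted; have: pairwise leo (enum 'I_n).
  have tr : transitive leo by move=> j i k; apply: leq_trans.
  rewrite -(sorted_pairwise tr).
  have := iota_sorted 0 n; rewrite -val_enum_ord sorted_map.
  exact.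
rewrite /expo_word; elim: (enum 'I_n) => //= i s IHs /andP[ilt /IHs sP].
rewrite pairwise_cat sP andbT; apply/andP; split.
  apply/allrelP => a b; rewrite mem_nseq => /andP[_ /eqP->].
  case/flatten_mapP => j js; rewrite mem_nseq => /andP[_ /eqP->].
  exact: (allP ilt).
by elim: (al i) => //= k ->; rewrite andbT all_nseq /leo leqnn orbT.
Qed.

Lemma wordprod_sorted s : sorted leo s -> wordprod s = mon (word_expo s).
Proof.
move=> ss; rewrite -wordprod_expo; congr wordprod.
apply: (sorted_eq (leT := leo)) ss (sorted_expo_word _) _.
- by move=> j i k; apply: leq_trans.
- by move=> i j; rewrite /leo -eqn_leq => /eqP/val_inj.
- exact: perm_expo_word.
Qed.

Lemma coords_sorted (a : R) s al : sorted leo s ->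
  co (iota a * wordprod s) al = if al == word_expo s then a else 0.
Proof. by move=> ss; rewrite wordprod_sorted // coords_term. Qed.

(** Induction along the generation of A by R and the variables. *)
Lemma pbw_ind (Q : A -> Prop) :
  (forall r, Q (iota r)) -> (forall f g, Q f -> Q g -> Q (f + g)) ->
  (forall f i, Q f -> Q (f * x i)) -> forall f, Q f.
Proof.
move=> Qr QD Qx f; rewrite (coordsE f); apply: big_ind => //.
  by rewrite -(rmorph0 iota).
move=> al _; rewrite -wordprod_expo.
elim/last_ind: (expo_word al) => [|s i IHs].
  by rewrite /wordprod big_nil mulr1.
by rewrite -cats1 wordprod_cat mulrA [wordprod [:: i]]big_seq1; apply: Qx.
Qed.

(** Comparing the two rewritings of x_i x_j into one another shows that the
    constants c_ij are units. *)
Lemma pbw_c_unit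
    (hcentral : forall (i j : 'I_n) (a : R), pbw_c P i j * a = a * pbw_c P i j)
    (i j : 'I_n) : i != j -> pbw_c P i j * pbw_c P j i = 1.
Proof.
wlog: i j / (i < j)%N => [hw ij|ij _].
  case: (ltngtP i j) => [lt|lt|/val_inj eqij]; first exact: hw.
    by rewrite hcentral; apply: hw; rewrite // eq_sym.
  by rewrite eqij eqxx in ij.
set u := x i * x j; set v := x j * x i.
have uE : u = wordprod [:: i; j] by rewrite /wordprod big_cons big_seq1.
have ss : sorted leo [:: i; j] by rewrite /= andbT; apply: ltnW.
(* The right-hand sides of the commutation relations are affine, so they do
   not involve the monomial x_i x_j. *)
have affine (a : 'I_n.+1 -> R) :
    co (iota (a ord0) + \sum_(l < n) iota (a (lift ord0 l)) * x l)
       (word_expo [:: i; j]) = 0.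
  rewrite coordsD coords_bigsum.
  have expo_size s : word_expo [:: i; j] = word_expo s -> size s = 2.
    move=> E; have /perm_size <- // : perm_eq [:: i; j] s.
    by rewrite (perm_trans (perm_expo_word E)) // perm_sym perm_expo_word.
  have -> : iota (a ord0) = iota (a ord0) * wordprod [::].
    by rewrite /wordprod big_nil mulr1.
  rewrite coords_sorted // big1 => [|l _].
    by case: eqP => [/expo_size|]; rewrite ?addr0.
  have -> : x l = wordprod [:: l] by rewrite /wordprod big_seq1.
  by rewrite coords_sorted //; case: eqP => [/expo_size|].
have Ev := pbw_comm P i j; have Eu := pbw_comm P j i.
rewrite -/u -/v in Ev Eu.
have cu : co u (word_expo [:: i; j]) = 1.
  by rewrite uE -(mul1r (wordprod _)) -(rmorph1 iota) coords_sorted // eqxx.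
have cv : co v (word_expo [:: i; j]) = pbw_c P i j.
  have := congr1 (fun f => co f (word_expo [:: i; j])) Ev.
  by rewrite affine coordsB coordsMl cu mulr1 => /subr0_eq.
have := congr1 (fun f => co f (word_expo [:: i; j])) Eu.
by rewrite affine coordsB coordsMl cu cv hcentral => /subr0_eq ->.
Qed.

End Coordinates.
(** * Elements with nilpotent coefficients *)

Section NilCoefficients.

Variables (n : nat) (R A : pzRingType) (P : skew_PBW n R A).
Variables (Sigma Delta : 'I_n -> R -> R).
Hypothesis hSD : associated_families P Sigma Delta.
Hypothesis hrev : reversible R.
Hypothesis hS : forall i (a b : R), a * Sigma i b = 0 <-> a * b = 0.
Hypothesis hD : forall i (a b : R), a * b = 0 -> a * Delta i b = 0.

Local Notation iota := (pbw_iota P).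
Local Notation mon := (monomial (pbw_x P)).
Local Notation co := (coords P).
Local Notation nil := (@is_nilpotent R).

Let nilR := nil_reduced_ideal hrev.
Let nilI := reduced_ideal_ideal nilR.

Lemma nil_Sigma i (a b : R) : nil (a * Sigma i b) <-> nil (a * b).
Proof. by split; apply: nil_subst => // z /hS. Qed.

Lemma nil_Delta i (a b : R) : nil (a * b) -> nil (a * Delta i b).
Proof. by apply: nil_subst => // z /hD. Qed.

Lemma nil_word_sigma s (a b : R) :
  nil (a * word_sigma Sigma s b) <-> nil (a * b).
Proof. by elim: s => //= i s IHs; rewrite nil_Sigma. Qed.

(** Moving a coefficient b to the left of an element of A only produces
    coefficients whose left annihilator contains that of b. *)
Lemma pbw_dominated (w : A) (b : R) : dominated iota b (w * iota b).
Proof.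
elim/(@pbw_ind _ _ _ P): w b => [r|f g IHf IHg|f i IHf] b.
- rewrite -rmorphM -(mulr1 (iota _)); constructor=> z.
  exact: reversible_ins.
- by rewrite mulrDl; constructor.
- rewrite -mulrA (assoc_rel hSD) mulrDr mulrA; constructor.
    by apply: dominated_trans (IHf _) => z; rewrite hS.
  by rewrite -(mulr1 (f * _)); apply: dominated_trans (IHf _) => z; apply: hD.
Qed.

(** All the coefficients of f are nilpotent. *)
Definition nilcoef (f : A) : Prop := forall al, nil (co f al).

Lemma nilcoef_iotaM (a : R) (w : A) : nil a -> nilcoef (iota a * w).
Proof. by move=> nila al; rewrite coordsMl; apply: (idealMr nilI). Qed.

Lemma nilcoef0 : nilcoef 0.
Proof. by move=> al; rewrite coords0; apply: (ideal0 nilI). Qed.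

Lemma nilcoefD f g : nilcoef f -> nilcoef g -> nilcoef (f + g).
Proof. by move=> nf ng al; rewrite coordsD; apply: (idealD nilI). Qed.

Lemma nilcoef_sum (I : Type) (s : seq I) (F : I -> A) :
  (forall i, nilcoef (F i)) -> nilcoef (\sum_(i <- s) F i).
Proof.
by move=> nF; apply: big_ind => //; [apply: nilcoef0 | apply: nilcoefD].
Qed.

Lemma nilcoefMr f w : nilcoef f -> nilcoef (f * w).
Proof.
move=> nf; rewrite (coordsE P f) mulr_suml; apply: nilcoef_sum => al.
by rewrite -mulrA; apply: nilcoef_iotaM.
Qed.

(** Modulo N, ab = 0 in R implies a A b = 0, for N the nilpotent elements. *)
Lemma nilcoef_sandwich (a b : R) (w : A) :
  nil (a * b) -> nilcoef (iota a * w * iota b).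
Proof.
move=> nab; rewrite -mulrA.
elim: (pbw_dominated w b) => [b' v bb'|v v' _ IHv _].
  by rewrite mulrA -rmorphM; apply/nilcoef_iotaM/(nil_subst hrev bb').
by rewrite mulrDr; apply: nilcoefD.
Qed.

Lemma nilcoef_ideal : ideal nilcoef.
Proof.
split; [exact: nilcoef0|exact: nilcoefD| |by move=> r f; apply: nilcoefMr].
move=> w f nf; rewrite (coordsE P f) mulr_sumr; apply: nilcoef_sum => al.
rewrite mulrA; apply: nilcoefMr; rewrite -(mul1r w) -(rmorph1 iota).
by apply: nilcoef_sandwich; rewrite mul1r.
Qed.

Lemma nilcoef_nil f : nilcoef f -> is_nilpotent f.
Proof. by move=> nf; rewrite (coordsE P f); apply: (nil_sum pbw_dominated). Qed.

Lemma nilcoefM (u g : A) :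
  (forall al be, nil (co u al * co g be)) -> nilcoef (u * g).
Proof.
move=> nug; rewrite (coordsE P u) (coordsE P g) mulr_suml.
apply: nilcoef_sum => al; rewrite mulr_sumr; apply: nilcoef_sum => be.
by rewrite mulrA; apply/nilcoefMr/nilcoef_sandwich.
Qed.

End NilCoefficients.

(** * The filtration by a weight on the variables *)

Section Weighted.

Variables (n : nat) (R A : pzRingType) (P : skew_PBW n R A).
Variables (Sigma Delta : 'I_n -> R -> R).
Hypothesis hSD : associated_families P Sigma Delta.
Hypothesis hcentral :
  forall (i j : 'I_n) (a : R), pbw_c P i j * a = a * pbw_c P i j.

Local Notation iota := (pbw_iota P).
Local Notation x := (pbw_x P).
Local Notation mon := (monomial (pbw_x P)).
Local Notation co := (coords P).
Local Notation X := (wordprod P).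

(** The condition [om_lt] makes the affine right-hand sides of the commutation
    relations of smaller weight than the quadratic left-hand sides. *)
Variable om : 'I_n -> nat.
Hypothesis om_gt0 : forall i, (0 < om i)%N.
Hypothesis om_lt : forall i j l, (om l < om i + om j)%N.

(** The weight of a word, and that of the monomial of an exponent. *)
Definition word_weight (s : seq 'I_n) : nat := \sum_(i <- s) om i.
Definition expo_weight (al : expo n) : nat := \sum_(i < n) al i * om i.

Lemma word_weight_cons i s : word_weight (i :: s) = (om i + word_weight s)%N.
Proof. exact: big_cons. Qed.

Lemma word_weight_cat s t :
  word_weight (s ++ t) = (word_weight s + word_weight t)%N.
Proof. exact: big_cat. Qed.

Lemma word_weight_perm s t : perm_eq s t -> word_weight s = word_weight t.
Proof. by move=> st; apply: perm_big. Qed.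

Lemma word_weight_expo al : word_weight (expo_word al) = expo_weight al.
Proof.
rewrite /word_weight big_flatten big_map big_enum /=.
by apply: eq_bigr => i _; rewrite big_nseq iter_addn_0 mulnC.
Qed.

(** The elements of weight less than d: the additive subgroup generated by
    the terms whose word has weight less than d. *)
Inductive low (d : nat) : A -> Prop :=
| low0 : low d 0
| lowD f g of low d f & low d g : low d (f + g)
| low_term r s of (word_weight s < d)%N : low d (iota r * X s).

Lemma low_Ml d r f : low d f -> low d (iota r * f).
Proof.
elim=> {f} [|f g _ IHf _ IHg|r' s sd]; first by rewrite mulr0; constructor.
  by rewrite mulrDr; constructor.
by rewrite mulrA -rmorphM; constructor.
Qed.

Lemma low_sum d (I : Type) (s : seq I) (F : I -> A) :
  (forall i, low d (F i)) -> low d (\sum_(i <- s) F i).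
Proof. by move=> lF; apply: big_ind => //; [apply: low0 | apply: lowD]. Qed.

Lemma low_Mx d i f : low d f -> low (om i + d) (x i * f).
Proof.
elim=> {f} [|f g _ IHf _ IHg|r s sd]; first by rewrite mulr0; constructor.
  by rewrite mulrDr; constructor.
rewrite mulrA (assoc_rel hSD) mulrDl -mulrA -wordprod_cons.
apply: lowD; constructor; first by rewrite word_weight_cons ltn_add2l.
exact: ltn_addl.
Qed.

Lemma low_Mr d s f : low d f -> low (d + word_weight s) (f * X s).
Proof.
elim=> {f} [|f g _ IHf _ IHg|r t td]; first by rewrite mul0r; constructor.
  by rewrite mulrDl; constructor.
rewrite -mulrA -wordprod_cat; constructor.
by rewrite word_weight_cat ltn_add2r.
Qed.

(** Moving a coefficient to the left of a word applies the endomorphisms. *)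
Lemma wordprod_iota s r :
  low (word_weight s) (X s * iota r - iota (word_sigma Sigma s r) * X s).
Proof.
elim: s => [|i s IHs] /=.
  by rewrite /wordprod big_nil mulr1 mul1r subrr; constructor.
rewrite wordprod_cons word_weight_cons -mulrA.
set t := word_sigma Sigma s r.
have -> : x i * (X s * iota r) - iota (Sigma i t) * (x i * X s) =
          x i * (X s * iota r - iota t * X s) + iota (Delta i t) * X s.
  rewrite mulrBr -addrA; congr (_ + _).
  by rewrite (mulrA (x i)) (assoc_rel hSD) mulrDl opprD addrNK mulrA.
apply: lowD; first exact: low_Mx.
by constructor; rewrite -[X in (X < _)%N]add0n ltn_add2r.
Qed.

(** Equality of two words up to a right invertible coefficient and terms of
    smaller weight. *)
Definition assoc (s t : seq 'I_n) : Prop :=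
  exists c d : R, c * d = 1 /\ low (word_weight s) (X s - iota c * X t).

Lemma assoc_refl s : assoc s s.
Proof.
exists 1, 1; split; first by rewrite mulr1.
by rewrite rmorph1 mul1r subrr; constructor.
Qed.

Lemma assoc_trans s t u : perm_eq s t -> assoc s t -> assoc t u -> assoc s u.
Proof.
move=> /word_weight_perm st [c [d [cd lst]]] [c' [d' [cd' ltu]]].
exists (c * c'), (d' * d); split; first by rewrite mulrA -(mulrA c) cd' mulr1.
have -> : X s - iota (c * c') * X u =
          (X s - iota c * X t) + iota c * (X t - iota c' * X u).
  by rewrite mulrBr addrA subrK rmorphM mulrA.
by apply: lowD => //; apply: low_Ml; rewrite st.
Qed.

Lemma assoc_cons i s t : perm_eq s t -> assoc s t -> assoc (i :: s) (i :: t).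
Proof.
move=> /word_weight_perm st [c [d [cd lst]]].
exists (Sigma i c), (Sigma i d); split.
  by rewrite -(assoc_sigma_mul hSD) cd (assoc_sigma_one hSD).
rewrite !wordprod_cons word_weight_cons.
have -> : x i * X s - iota (Sigma i c) * (x i * X t) =
          x i * (X s - iota c * X t) + iota (Delta i c) * X t.
  rewrite mulrBr -addrA; congr (_ + _).
  by rewrite (mulrA (x i)) (assoc_rel hSD) mulrDl opprD addrNK mulrA.
apply: lowD; first exact: low_Mx.
by constructor; rewrite -st -[X in (X < _)%N]add0n ltn_add2r.
Qed.

Lemma assoc_swap i j s : assoc [:: j, i & s] [:: i, j & s].
Proof.
have [->|ij] := eqVneq i j; first exact: assoc_refl.
exists (pbw_c P i j), (pbw_c P j i); split; first exact: pbw_c_unit.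
rewrite !wordprod_cons !mulrA -mulrBl -!mulrA pbw_comm mulrDl mulr_suml.
rewrite !word_weight_cons; apply: lowD; last apply: low_sum => l.
  constructor.
  by rewrite addnA -[X in (X < _)%N]add0n ltn_add2r addn_gt0 om_gt0.
rewrite -mulrA -wordprod_cons; constructor.
by rewrite word_weight_cons addnA ltn_add2r.
Qed.

Lemma assoc_insert i s t : assoc (i :: s ++ t) (s ++ i :: t).
Proof.
elim: s => [|j s IHs] /=; first exact: assoc_refl.
apply: assoc_trans (assoc_swap _ _ _) _.
  by rewrite (perm_catCA [:: i] [:: j]).
by apply: assoc_cons IHs; rewrite (perm_catCA [:: i] s).
Qed.

Lemma assoc_perm s t : perm_eq s t -> assoc s t.
Proof.
elim: s t => [|i s IHs] t st.
  by move/perm_size/esym/size0nil: st => ->; apply: assoc_refl.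
have it : i \in t by rewrite -(perm_mem st) mem_head.
case/splitPr: it st => t1 t2 st.
have st12 : perm_eq s (t1 ++ t2).
  by move: st; rewrite -[i :: t2]cat1s perm_sym perm_catCA perm_cons perm_sym.
apply: assoc_trans (assoc_insert _ _ _); first by rewrite /= perm_cons.
by apply: assoc_cons (IHs _ st12).
Qed.

(** The words of smaller weight being again combinations of monomials of
    smaller weight, [low] controls the coordinates. *)
Lemma low_coords d f al : low d f -> (d <= expo_weight al)%N -> co f al = 0.
Proof.
elim/ltn_ind: d f al => d IHd f al lf dal.
elim: lf => {f} [|f g _ IHf _ IHg|r s sd]; first exact: coords0.
  by rewrite coordsD IHf IHg addr0.
have /assoc_perm [c [c' [_ lows]]] := perm_expo_word (erefl (word_expo s)).
rewrite wordprod_expo in lows.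
rewrite coordsMl -[X s](subrK (iota c * mon (word_expo s))).
rewrite coordsD coords_term (IHd _ sd _ _ lows) ?(leq_trans (ltnW sd)) //.
case: eqP => [alE|_]; last by rewrite addr0 mulr0.
move: dal; rewrite alE -word_weight_expo.
rewrite -(word_weight_perm (perm_expo_word (erefl _))).
by rewrite leqNgt sd.
Qed.

(** The sum of two exponents. *)
Definition expo_add (al be : expo n) : expo n := [ffun i => al i + be i]%N.

Lemma expo_weight_add al be :
  expo_weight (expo_add al be) = (expo_weight al + expo_weight be)%N.
Proof.
rewrite -big_split /=; apply: eq_bigr => i _.
by rewrite ffunE mulnDl.
Qed.

(** The leading term of a product of two terms; the endomorphism sigma^al is
    taken along the increasing word of al. *)
Lemma low_mul (a b : R) (al be : expo n) : exists c d : R, c * d = 1 /\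
  low (expo_weight al + expo_weight be)
    (iota a * mon al * (iota b * mon be)
     - iota (a * word_sigma Sigma (expo_word al) b * c) * mon (expo_add al be)).
Proof.
have pE : perm_eq (expo_word al ++ expo_word be) (expo_word (expo_add al be)).
  apply: perm_expo_word; apply/ffunP => i.
  by rewrite !ffunE count_cat !count_expo_word.
have [c [d [cd lcd]]] := assoc_perm pE; exists c, d; split=> //.
set t := word_sigma _ _ _.
rewrite -!wordprod_expo -!word_weight_expo -word_weight_cat.
have -> : iota a * X (expo_word al) * (iota b * X (expo_word be)) -
          iota (a * t * c) * X (expo_word (expo_add al be)) =
   iota a * ((X (expo_word al) * iota b - iota t * X (expo_word al))
               * X (expo_word be))
   + iota (a * t) * (X (expo_word al ++ expo_word be)
       - iota c * X (expo_word (expo_add al be))).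
  rewrite mulrBl mulrBr mulrBr !rmorphM wordprod_cat !mulrA addrA.
  by rewrite subrK.
apply: lowD; apply: low_Ml => //.
by rewrite word_weight_cat; apply/low_Mr/wordprod_iota.
Qed.

Lemma coords_mul (a b : R) (al be : expo n) : exists c d : R, c * d = 1 /\
  forall ga, (expo_weight al + expo_weight be <= expo_weight ga)%N ->
    co (iota a * mon al * (iota b * mon be)) ga =
    if ga == expo_add al be then a * word_sigma Sigma (expo_word al) b * c
    else 0.
Proof.
have [c [d [cd lab]]] := low_mul a b al be; exists c, d; split=> // ga le.
by have := low_coords lab le; rewrite coordsB coords_term => /subr0_eq.
Qed.

(** ** Leading coefficients modulo the nilpotent elements *)

Hypothesis hrev : reversible R.
Hypothesis hS : forall i (a b : R), a * Sigma i b = 0 <-> a * b = 0.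
Hypothesis hD : forall i (a b : R), a * b = 0 -> a * Delta i b = 0.

Local Notation nil := (@is_nilpotent R).
Local Notation nilcoef := (nilcoef P).

Let nilR := nil_reduced_ideal hrev.
Let nilI := reduced_ideal_ideal nilR.
Let nilcI := nilcoef_ideal hSD hrev hS hD.

(** The coefficients of weight at least d are nilpotent. *)
Definition nil_above (d : nat) (f : A) : Prop :=
  forall al, (d <= expo_weight al)%N -> nil (co f al).

Lemma nil_above_sum d (I : Type) (s : seq I) (F : I -> A) :
  (forall i, nil_above d (F i)) -> nil_above d (\sum_(i <- s) F i).
Proof.
move=> nF al dal; rewrite coords_bigsum.
by apply: big_ind => [||i _]; [apply: ideal0 nilI|apply: idealD nilI|apply: nF].
Qed.

Lemma nil_aboveM d e D f g : (d + e <= D.+1)%N ->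
  nil_above d f -> nil_above e g -> nil_above D (f * g).
Proof.
move=> deD nf ng; rewrite (coordsE P f) (coordsE P g) mulr_suml.
apply: nil_above_sum => al; rewrite mulr_sumr; apply: nil_above_sum => be.
have [/nf na|ald] := leqP d (expo_weight al).
  by move=> ga _; rewrite -mulrA; apply: nilcoef_iotaM.
have [/ng nb|bee] := leqP e (expo_weight be).
  move=> ga _; apply: (idealMl nilcI); exact: nilcoef_iotaM.
move=> ga Dga; have [c [c' [_ cE]]] := coords_mul (co f al) (co g be) al be.
have lt : (expo_weight al + expo_weight be < D)%N.
  rewrite -ltnS; apply: leq_trans deD; rewrite -addnS -addSn.
  exact: leq_add.
rewrite cE ?(ltnW (leq_trans lt Dga)) //; case: eqP => [gaE|_].
  by move: lt; rewrite -expo_weight_add -gaE ltnNge Dga.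
exact: (ideal0 nilI).
Qed.

(** The list s contains, in strictly decreasing order of weight, all the
    exponents at which the coefficient of f is not nilpotent. *)
Definition covers (s : seq (expo n)) (f : A) : Prop :=
  sorted gtn (map expo_weight s) /\ forall al, al \notin s -> nil (co f al).

Lemma covers_head al s f : covers (al :: s) f ->
  nil_above (expo_weight al).+1 f.
Proof.
move=> [/= ss fs] be albe; apply: fs; apply/negP; rewrite in_cons.
case/predU1P => [beE|/(map_f expo_weight) bes].
  by rewrite beE ltnn in albe.
have := allP (order_path_min (rev_trans ltn_trans) ss) _ bes.
by rewrite /= ltnNge (ltnW albe).
Qed.

Lemma covers_tail al s f : covers (al :: s) f ->
  nil_above (expo_weight al) (f - iota (co f al) * mon al).
Proof.
move=> cf be albe; rewrite coordsB coords_term; case: eqP => [->|/eqP beal].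
  by rewrite subrr; apply: (ideal0 nilI).
rewrite subr0; case: cf => /= ss fs; apply: fs.
rewrite in_cons (negbTE beal) /=; apply/negP => /(map_f expo_weight) bes.
have := allP (order_path_min (rev_trans ltn_trans) ss) _ bes.
by rewrite /= ltnNge albe.
Qed.

Lemma covers_sub al s f : covers (al :: s) f ->
  covers s (f - iota (co f al) * mon al).
Proof.
move=> [/= /path_sorted ss fs]; split=> // be bes.
rewrite coordsB coords_term; case: eqP => [->|/eqP beal].
  by rewrite subrr; apply: (ideal0 nilI).
by rewrite subr0; apply: fs; rewrite in_cons negb_or beal.
Qed.

Lemma covers_iotaM al s f (r : R) : covers (al :: s) f -> nil (r * co f al) ->
  covers s (iota r * f).
Proof.
move=> [/= /path_sorted ss fs] nral; split=> // be bes; rewrite coordsMl.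
have [->//|beal] := eqVneq be al.
by apply: (idealMl nilI); apply: fs; rewrite in_cons negb_or beal.
Qed.

(** If all the coefficients of ug are nilpotent, so is the product of the
    leading coefficients of u and g. *)
Lemma covers_lead al be s t u g : covers (al :: s) u -> covers (be :: t) g ->
  nilcoef (u * g) -> nil (co u al * co g be).
Proof.
move=> cu cg nug; set a := co u al; set b := co g be.
have [c [d [cd cE]]] := coords_mul a b al be.
set u' := u - iota a * mon al; set g' := g - iota b * mon be.
pose ga := expo_add al be; have gaE := expo_weight_add al be.
have E : iota a * mon al * (iota b * mon be) =
         u * g - u' * g - iota a * mon al * g'.
  have uE : u - u' = iota a * mon al by rewrite /u' opprB addrC subrK.
  have gE : g - g' = iota b * mon be by rewrite /g' opprB addrC subrK.
  by rewrite -mulrBl uE -mulrBr gE.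
have a_above : nil_above (expo_weight al).+1 (iota a * mon al).
  move=> de lt; rewrite coords_term; case: eqP lt => [->|_ _].
    by rewrite ltnn.
  exact: (ideal0 nilI).
have n1 : nil (co (u' * g) ga).
  apply: (nil_aboveM _ (covers_tail cu) (covers_head cg)); last exact: leqnn.
  by rewrite addnS -gaE.
have n2 : nil (co (iota a * mon al * g') ga).
  apply: (nil_aboveM _ a_above (covers_tail cg)); last exact: leqnn.
  by rewrite addSn -gaE.
have: nil (co (iota a * mon al * (iota b * mon be)) ga).
  rewrite E !coordsB; apply: (idealB nilI) => //.
  exact: (idealB nilI).
rewrite cE ?gaE // eqxx => /(idealMr nilI d).
by rewrite -mulrA cd mulr1 (nil_word_sigma hrev hS).
Qed.

(** The leading coefficient of f has nilpotent square, hence is nilpotent, and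
    its term can be removed. *)
Lemma covers_sqr s f : covers s f -> nilcoef (f * f) -> nilcoef f.
Proof.
elim: s f => [|al s IHs] f cf nff; first by move=> al; apply: (proj2 cf).
have na : nil (co f al) := reduced_ideal_sqr nilR (covers_lead cf cf nff).
have nt : nilcoef (iota (co f al) * mon al) by apply: nilcoef_iotaM.
rewrite -(subrK (iota (co f al) * mon al) f); apply: (idealD nilcI) => //.
apply: IHs; first exact: covers_sub.
rewrite mulrBl; apply: (idealB nilcI); last exact: (idealMr nilcI).
by rewrite mulrBr; apply: (idealB nilcI) => //; apply: (idealMl nilcI).
Qed.

(** The Armendariz property modulo the nilpotent elements. The leading
    coefficient a of u annihilates the leading coefficient of g; hence a g has
    fewer terms, and so has u once a is known to annihilate all of g. *)
Lemma covers_armendariz (hnc : reduced_ideal nilcoef) s t u g :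
  covers s u -> covers t g -> nilcoef (u * g) ->
  forall al be, nil (co u al * co g be).
Proof.
elim: s u t g => [|al s IHs] u t g cu cg nug.
  by move=> al be; apply: (idealMr nilI); apply: (proj2 cu).
have nal be : nil (co u al * co g be).
  elim: t g cg nug be => [|be t IHt] g cg nug.
    by move=> be; apply: (idealMl nilI); apply: (proj2 cg).
  move=> be'; have cag := covers_iotaM cg (covers_lead cu cg nug).
  apply: (reduced_ideal_cancel nilR); rewrite -mulrA -coordsMl.
  by apply: IHt cag _ _; rewrite mulrA; apply: (reduced_ideal_ins hnc).
move=> al' be; have [->|al'N] := eqVneq al' al; first exact: nal.
have nag : nilcoef (iota (co u al) * mon al * g).
  apply: (nilcoefM hSD hrev hS hD) => de be'; rewrite coords_term.
  case: eqP => // _; rewrite mul0r; exact: (ideal0 nilI).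
have := IHs _ t g (covers_sub cu) cg _ al' be.
rewrite coordsB coords_term (negbTE al'N) subr0; apply.
by rewrite mulrBl; apply: (idealB nilcI).
Qed.

End Weighted.
(** * Weights separating finitely many exponents *)

(** The value in base B of n digits is less than B^n and determines them. *)
Lemma digits_lt (B n : nat) (f : 'I_n -> nat) :
  (forall i, f i < B)%N -> (\sum_(i < n) f i * B ^ i < B ^ n)%N.
Proof.
elim: n f => [|n IHn] f fB; first by rewrite big_ord0.
rewrite big_ord_recl expn0 muln1.
under eq_bigr => i _ do rewrite lift0 expnS mulnCA.
rewrite -big_distrr /= expnS.
have lt := IHn (fun i => f (lift ord0 i)) (fun i => fB _).
apply: leq_trans (_ : B * (\sum_(i < n) f (lift ord0 i) * B ^ i).+1 <= _)%N.
  by rewrite mulnS ltn_add2r.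
by rewrite leq_mul2l lt orbT.
Qed.

Lemma digits_inj (B n : nat) (f g : 'I_n -> nat) :
  (forall i, f i < B)%N -> (forall i, g i < B)%N ->
  (\sum_(i < n) f i * B ^ i = \sum_(i < n) g i * B ^ i)%N -> f =1 g.
Proof.
elim: n f g => [|n IHn] f g fB gB; first by move=> _ [].
rewrite !big_ord_recl expn0 !muln1.
under eq_bigr => i _ do rewrite lift0 expnS mulnCA.
under [in RHS]eq_bigr => i _ do rewrite lift0 expnS mulnCA.
rewrite -!big_distrr /= => E.
have B0 : (0 < B)%N by apply: leq_ltn_trans (fB ord0).
have E0 : f ord0 = g ord0.
  have := congr1 (modn^~ B) E.
  by rewrite /= ![(B * _)%N]mulnC ![(_ + _ * B)%N]addnC !modnMDl !modn_small.
have Es : (fun i => f (lift ord0 i)) =1 (fun i => g (lift ord0 i)).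
  apply: IHn => //; move/eqP: E.
  by rewrite E0 eqn_add2l eqn_pmul2l // => /eqP.
by move=> i; case: (unliftP ord0 i) => [j ->|->//]; apply: Es.
Qed.

Section SeparatingWeight.

Variables (n B : nat).
Hypothesis B_gt1 : (1 < B)%N.

(** The summand B^n makes the total degree dominant; the summand B^i separates
    the exponents of equal degree with entries less than B. *)
Definition sep_weight (i : 'I_n) : nat := (B ^ n + B ^ i)%N.

Lemma sep_weight_gt0 i : (0 < sep_weight i)%N.
Proof. by rewrite addn_gt0 expn_gt0 (ltnW B_gt1). Qed.

Lemma sep_weight_lt i j l : (sep_weight l < sep_weight i + sep_weight j)%N.
Proof.
rewrite /sep_weight -addnA ltn_add2l.
apply: (leq_trans (n := (B ^ n)%N)); first by rewrite ltn_exp2l.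
by rewrite (leq_trans (leq_addr (B ^ j) _)) // leq_addl.
Qed.

Lemma sep_weight_inj (al be : expo n) :
  (forall i, al i < B)%N -> (forall i, be i < B)%N ->
  expo_weight sep_weight al = expo_weight sep_weight be -> al = be.
Proof.
move=> alB beB; rewrite /expo_weight.
under eq_bigr => i _ do rewrite mulnDr.
under [in RHS]eq_bigr => i _ do rewrite mulnDr.
rewrite !big_split /= -!big_distrl /= => /(congr1 (modn^~ (B ^ n)%N)) /=.
rewrite !modnMDl !modn_small ?digits_lt // => /digits_inj E.
by apply/ffunP/E.
Qed.

End SeparatingWeight.

Lemma expo_bound (n : nat) (s : seq (expo n)) :
  exists2 B, (1 < B)%N & forall al i, al \in s -> (al i < B)%N.
Proof.
exists (\max_(al <- s) \max_(i < n) al i).+2 => // al i als.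
rewrite ltnS leqW //; apply: leq_trans (leq_bigmax_seq _ als _) => //.
exact: (leq_bigmax (F := fun i => al i)).
Qed.

(** * Nilpotent elements of a skew PBW extension *)

(** At a unit exponent, an iterated family is one of its members. *)
Lemma iter_family_unit (n : nat) (T : Type) (u : 'I_n -> T -> T) i a :
  iter_family u [ffun j => (j == i) : nat] a = u i a.
Proof.
rewrite /iter_family.
have: uniq (index_enum 'I_n) by apply: index_enum_uniq.
have: i \in index_enum 'I_n by apply: mem_index_enum.
suff E (s : seq 'I_n) : uniq s ->
    (\big[(fun f g : T -> T => f \o g)/id]_(j <- s)
        iter ([ffun j => (j == i) : nat] j) (u j)) a =
    if i \in s then u i a else a.
  by move=> iI /E ->; rewrite iI.
elim: s => [_|j s IHs /= /andP[js us]]; first by rewrite big_nil.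
rewrite big_cons /= IHs // ffunE in_cons eq_sym.
by case: eqP js => [<- /negbTE ->|_ _].
Qed.

Section Main.

Variables (n : nat) (R A : pzRingType) (P : skew_PBW n R A).
Variables (Sigma Delta : 'I_n -> R -> R).
Hypothesis hSD : associated_families P Sigma Delta.
Hypothesis hcentral :
  forall (i j : 'I_n) (a : R), pbw_c P i j * a = a * pbw_c P i j.
Hypothesis hcompat : SD_compatible Sigma Delta.
Hypothesis hrev : reversible R.

Local Notation nilcoef := (nilcoef P).
Local Notation co := (coords P).

Let hS i (a b : R) : a * Sigma i b = 0 <-> a * b = 0.
Proof.
have [/(_ [ffun j => (j == i) : nat])] := hcompat a b.
by rewrite iter_family_unit.
Qed.

Let hD i (a b : R) : a * b = 0 -> a * Delta i b = 0.
Proof.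
have [_ h] := hcompat a b => /h /(_ [ffun j => (j == i) : nat]).
by rewrite iter_family_unit.
Qed.

Lemma covers_exists (B : nat) (f : A) :
  (forall al i, al \in finsupp (co f) -> (al i < B)%N) ->
  exists s, covers P (sep_weight B) s f.
Proof.
move=> fB; pose w := expo_weight (sep_weight (n := n) B).
exists (sort (relpre w geq) (finsupp (co f))); split.
  rewrite gtn_sorted_uniq_geq map_inj_in_uniq ?sort_uniq ?fset_uniq /=.
    rewrite sorted_map; apply: sort_sorted => al be.
    exact: leq_total.
  move=> al be; rewrite !mem_sort => fal fbe.
  by apply: sep_weight_inj => i; apply: fB.
move=> al; rewrite mem_sort => /fsfun_dflt ->.
exact: (ideal0 (reduced_ideal_ideal (nil_reduced_ideal hrev))).
Qed.

Lemma nilcoef_reduced_ideal : reduced_ideal nilcoef.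
Proof.
split; first exact: (nilcoef_ideal hSD hrev hS hD).
move=> f nff; have [B B1 fB] := expo_bound (finsupp (co f)).
have [s cf] := covers_exists fB.
apply: (covers_sqr hSD hcentral _ _ hrev hS hD cf nff).
- exact: sep_weight_gt0.
- exact: sep_weight_lt.
Qed.

(** If all the coefficients of ug are nilpotent, so are all the products of a
    coefficient of u and one of g. *)
Lemma nilcoef_armendariz (u g : A) :
  nilcoef (u * g) -> forall al be, is_nilpotent (co u al * co g be).
Proof.
move=> nug; have [B B1 sB] := expo_bound (finsupp (co u) ++ finsupp (co g)).
have [|s cu] := @covers_exists B u.
  by move=> al i al_u; apply: sB; rewrite mem_cat al_u.
have [|t cg] := @covers_exists B g.
  by move=> al i al_g; apply: sB; rewrite mem_cat al_g orbT.
have hnc := nilcoef_reduced_ideal.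
apply: (covers_armendariz hSD hcentral _ _ hrev hS hD hnc cu cg nug).
- exact: sep_weight_gt0.
- exact: sep_weight_lt.
Qed.

(** An element of A is nilpotent exactly when its coefficients are. *)
Lemma nil_iff_nilcoef (f : A) : is_nilpotent f <-> nilcoef f.
Proof.
split; first exact: (reduced_ideal_nil nilcoef_reduced_ideal).
exact: (nilcoef_nil hSD hrev hS hD).
Qed.

Lemma base_weak_symmetric : weak_SD_symmetric Sigma Delta.
Proof.
move=> a b c i /(reduced_ideal_swap (nil_reduced_ideal hrev)) acb.
by split; [apply/(nil_Sigma hrev hS) | apply: (nil_Delta hrev hD)].
Qed.

Lemma pbw_weak_symmetric :
  weak_SD_symmetric (coefwise_family P Sigma) (coefwise_family P Delta).
Proof.
move=> f g h i /nil_iff_nilcoef.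
move=> /(reduced_ideal_swap nilcoef_reduced_ideal)/nilcoef_armendariz fhg.
have add0 (u : R -> R) : {morph u : r s / r + s} -> u 0 = 0.
  by move=> uD; apply: (addrI (u 0)); rewrite -uD !addr0.
split; apply/nil_iff_nilcoef/(nilcoefM hSD hrev hS hD) => al be.
  rewrite coords_coefwise; last exact/add0/(assoc_sigma_add hSD).
  exact/(nil_Sigma hrev hS).
rewrite coords_coefwise; last exact/add0/(assoc_delta_add hSD).
exact: (nil_Delta hrev hD).
Qed.

End Main.

Theorem theorem5p6 (n : nat) (R A : pzRingType) (P : skew_PBW n R A)
    (Sigma Delta : 'I_n -> R -> R)
    (hSD : associated_families P Sigma Delta)
    (hcentral : forall (i j : 'I_n) (a : R), pbw_c P i j * a = a * pbw_c P i j)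
    (hsd : forall (i j : 'I_n) (a : R),
       Sigma i (Delta j a) = Delta j (Sigma i a))
    (hdd : forall (i j : 'I_n) (a : R),
       Delta i (Delta j a) = Delta j (Delta i a))
    (hdc : forall i j k : 'I_n, Delta k (pbw_c P i j) = 0)
    (hdr : forall (i j k : 'I_n) (l : 'I_n.+1), Delta k (pbw_r P i j l) = 0)
    (hcompat : SD_compatible Sigma Delta)
    (hrev : reversible R) :
  weak_SD_symmetric Sigma Delta <->
  weak_SD_symmetric (coefwise_family P Sigma) (coefwise_family P Delta).
Proof.
split=> _; first exact: pbw_weak_symmetric.
exact: base_weak_symmetric.
Qed.
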